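(* Define $\mathcal I^{\star}=\{i\in[V]:\mathcal C_i\cap\operatorname{argmin}_{u\in\mathbb R^r}g_0(u)\neq\emptyset\}$ and $$\alpha=\min_{u\in\bigcup_{i\in[V]\setminus\mathcal I^{\star}}\mathcal C_i}g_0(u)-\min_{u\in\mathbb R^r}g_0(u),\qquad \gamma_i=\operatorname{dist}\left(\mathrm Bv^{(i)},\operatorname{bd}(\mathcal C_i)\right)\quad(i\in\mathcal I^{\star}),$$ $$\Delta_i=\min\left\{\kappa_{c-\mathrm B^{\intercal}\mathrm Bv^{(i)}},\ \frac{\gamma_i}{2}\min_{\substack{k\in[V]\\ \mathrm Bv^{(k)}\neq \mathrm Bv^{(i)}}}\left\|\mathrm Bv^{(k)}-\mathrm Bv^{(i)}\right\|\right\}\quad(i\in\mathcal I^{\star}),$$ $\gamma=\min_{i\in\mathcal I^{\star}}\gamma_i$ and $\Delta=\min_{i\in\mathcal I^{\star}}\Delta_i$. Then $\alpha>0$, and $\gamma_i>0$, $\Delta_i>0$ for every $i\in\mathcal I^{\star}$. Moreover, for any $$0<\varepsilon<\min\left\{\frac{\alpha}{R_{\mathsf H}},\frac{\gamma^2}{8R_{\mathsf H}},\frac{\Delta}{R_1+R_{\mathsf H}}\right\}$$ and any solution $x^\star_\varepsilon$ of $\min_{x\in\mathcal K}\{-\frac12x^{\intercal}\mathrm Mx+c^{\intercal}x-\varepsilon\mathsf H(x)\}$, $$\operatorname{dist}\left(x^\star_\varepsilon,\ \operatorname{argmin}_{x\in\mathcal K}\left\{-\tfrac12x^{\intercal}\mathrm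 Mx+c^{\intercal}x\right\}\right)\le 2R_1\exp\left(\frac{-\Delta}{2\varepsilon R_1}+\frac{R_1+R_{\mathsf H}}{R_1}\right).$$
   Context: Let $\mathrm A\in\mathbb R^{m\times n}$, $b\in\mathbb R^m$, $c\in\mathbb R^n$, $\mathcal K=\{x\in\mathbb R^n:\mathrm Ax=b,\ x\ge 0\}$, and let $\mathrm M\in\mathbb R^{n\times n}$ be symmetric positive semidefinite, written $\mathrm M=\mathrm B^{\intercal}\mathrm B$ with $\mathrm B\in\mathbb R^{r\times n}$, $r\le n$. Standing assumption: $\mathcal K$ is nonempty and bounded, and $x\mapsto-\frac12x^{\intercal}\mathrm Mx+c^{\intercal}x$ is nonconstant on $\mathcal K$. Entropy: $\mathsf H(x)=-\sum_{i=1}^nx_i\log x_i$ if $x\ge0$ (with $0\log 0=0$), and $\mathsf H(x)=-\infty$ otherwise. $R_{\mathsf H}=\max_{x,x'\in\mathcal K}\{\mathsf H(x)-\mathsf H(x')\}$, $R_1=\max_{x\in\mathcal K}\|x\|_1$. $\mathcal V(\mathcal K)=\{v^{(i)}\}_{i=1}^V$ is the set of vertices of $\mathcal K$, $[V]=\{1,\dots,V\}$, and $\mathcal C_i=\{u\in\mathbb R^r:(c-\mathrm B^{\intercal}u)^{\intercal}v^{(i)}\le(c-\mathrm B^{\intercal}u)^{\intercal}v^{(j)}\text{ for every }j\ne i\}$. For $\varepsilon\ge0$, $g_\varepsilon(u)=\frac12\|u\|^2+\min_{x\in\mathcal K}\{(c-\mathrm B^{\intercal}u)^{\intercal}x-\varepsilon\mathsf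 H(x)\}$, $u\in\mathbb R^r$. For $d\in\mathbb R^n$: $\mathcal O_d=\operatorname{argmin}_{x\in\mathcal K}d^{\intercal}x$ and $\kappa_d=\min_{x\in\mathcal V(\mathcal K)\setminus\mathcal O_d}d^{\intercal}x-\min_{x\in\mathcal O_d}d^{\intercal}x$. $\|\cdot\|$ is the Euclidean norm, $\operatorname{dist}(z,\mathcal C)=\inf_{z'\in\mathcal C}\|z-z'\|$, $\operatorname{bd}$ denotes boundary. Minima/infima over empty sets are $+\infty$ (so $\alpha,\gamma_i$, etc. may equal $+\infty$). *)

(* Defs.v *)
From HB Require Import structures.
From mathcomp Require Import all_boot all_order all_algebra.
From mathcomp Require Import all_classical all_reals all_analysis.

Set Implicit Arguments.
Unset Strict Implicit.
Unset Printing Implicit Defensive.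

Import Order.TTheory GRing.Theory Num.Theory.
Import numFieldNormedType.Exports.

Local Open Scope classical_set_scope.
Local Open Scope ring_scope.

(* Every minimum, maximum or distance is the infimum or supremum in [\bar R] of
   the set of values: it is the minimum or maximum whenever that is attained, and
   the infimum of the empty set is [+oo]. *)

Section Euclidean.
Context {R : realType} {n : nat}.
Implicit Types (x y : 'cV[R]_n) (S : set 'cV[R]_n).

Definition dotv x y : R := (x^T *m y) 0 0.

(* The library norm [`|x|] on ['cV[R]_n] is the sup norm, hence these two. *)
Definition l2norm x : R := Num.sqrt (\sum_(i < n) x i 0 ^+ 2).

Definition l1norm x : R := \sum_(i < n) `|x i 0|.

Definition dist x S : \bar R := ereal_inf [set (l2norm (x - y))%:E | y in S].

(* The library topology on ['cV[R]_n] is the product topology, which is the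
   Euclidean one. *)
Definition bd S : set 'cV[R]_n := closure S `\` interior S.

(* The vertices of a polyhedron, as its extreme points. *)
Definition vertices S : set 'cV[R]_n :=
  [set x | S x /\ forall y z (t : R), S y -> S z -> 0 < t < 1 ->
             x = t *: y + (1 - t) *: z -> y = x /\ z = x].

(* [ln 0 = 0] in the library; in any case the factor [x i 0] vanishes there. *)
Definition entropy x : \bar R :=
  if [forall i, 0 <= x i 0] then (- \sum_(i < n) x i 0 * ln (x i 0))%:E
  else -oo%E.

End Euclidean.

Definition argmin {T : Type} {disp : Order.disp_t} {Y : porderType disp}
    (S : set T) (f : T -> Y) : set T :=
  [set x | S x /\ forall y, S y -> (f x <= f y)%O].

Section Polytope.
Context {R : realType} {m n : nat}.

Definition polyhedron (A : 'M[R]_(m, n)) (b : 'cV[R]_m) : set 'cV[R]_n :=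
  [set x | A *m x = b /\ forall i, 0 <= x i 0].

Definition objective (M : 'M[R]_n) (c x : 'cV[R]_n) : R :=
  - (2^-1 * dotv x (M *m x)) + dotv c x.

Local Open Scope ereal_scope.

Implicit Type K : set 'cV[R]_n.

Definition RH K : \bar R :=
  ereal_sup [set entropy x - entropy x' | x in K & x' in K].

Definition R1 K : \bar R := ereal_sup [set (l1norm x)%:E | x in K].

Definition kappa K (d : 'cV[R]_n) : \bar R :=
  ereal_inf [set (dotv d x)%:E | x in vertices K `\` argmin K (dotv d)]
  - ereal_inf [set (dotv d x)%:E | x in argmin K (dotv d)].

End Polytope.

Section Dual.
Context {R : realType} {n r V : nat}.
Variables (K : set 'cV[R]_n) (c : 'cV[R]_n) (B : 'M[R]_(r, n)).
Variable v : 'I_V -> 'cV[R]_n.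

Definition cell (i : 'I_V) : set 'cV[R]_r :=
  [set u | forall j, j != i ->
     dotv (c - B^T *m u) (v i) <= dotv (c - B^T *m u) (v j)].

Local Open Scope ereal_scope.

Definition gfun (eps : R) (u : 'cV[R]_r) : \bar R :=
  (2^-1 * l2norm u ^+ 2)%R%:E
  + ereal_inf [set (dotv (c - B^T *m u) x)%:E - eps%:E * entropy x | x in K].

Definition Istar : set 'I_V :=
  [set i | (cell i `&` argmin setT (gfun 0)) !=set0].

Definition alpha : \bar R :=
  ereal_inf [set gfun 0 u | u in \bigcup_(i in ~` Istar) cell i]
  - ereal_inf [set gfun 0 u | u in setT].

Definition gamma_ (i : 'I_V) : \bar R := dist (B *m v i) (bd (cell i)).

Definition Delta_ (i : 'I_V) : \bar R :=
  mine (kappa K (c - B^T *m (B *m v i)))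
       (gamma_ i / 2%:E *
        ereal_inf [set (l2norm (B *m v k - B *m v i))%:E
                  | k in [set k | B *m v k <> B *m v i]]).

Definition gamma_min : \bar R := ereal_inf [set gamma_ i | i in Istar].

Definition Delta_min : \bar R := ereal_inf [set Delta_ i | i in Istar].

End Dual.

(* Main.v *)
Require Import Defs.
From HB Require Import structures.
From mathcomp Require Import all_boot all_order all_algebra.
From mathcomp Require Import all_classical all_reals all_analysis.
From mathcomp Require Import ring lra.

Set Implicit Arguments.
Unset Strict Implicit.
Unset Printing Implicit Defensive.

Import Order.TTheory GRing.Theory Num.Theory.
Import numFieldNormedType.Exports.

Local Open Scope classical_set_scope.
Local Open Scope ring_scope.

(** Write f(x) = - x^T M x / 2 + c^T x with M = B^T B, and d_u = c - B^T u.
    Completing the square gives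
      |u|^2 / 2 + d_u . x = |u - B x|^2 / 2 + f(x),
    which is [linearized_objective]; it says both that the linear function d_u,
    up to a constant, lies above f and touches it wherever B x = u, and that on
    the cell of a vertex v_i, where v_i minimizes d_u over the polytope, the dual
    function g_0 equals |u - B v_i|^2 / 2 + f(v_i) ([gfun0_cell]). Everything
    about g_0 and the cells is read off from this formula: g_0 is minimized
    exactly at the points B v_i for which v_i minimizes f ([IstarP]), so that
    alpha is at least a gap between finitely many values of f ([alpha_gt0]); and
    at such a point the j-th inequality of the cell holds with slack at least
    |B v_j - B v_i|^2 / 2 ([slack_ge]), which is positive unless the inequality
    does not depend on u, so that B v_i is interior to its cell ([gamma_gt0]).

    Let x now solve the problem regularized by eps. As f lies below d_u for
    u = B x, the point x also solves the regularized linear program of cost d_u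
    ([entropic_solution_linearized]). Moreover g_0(u) <= f(x) <= min f + eps R_H.
    As eps R_H < alpha, u lies in the cell of an optimal vertex v_i, and then
    |u - B v_i|^2 / 2 <= eps R_H ([entropic_solution_cell]), whence
    |u - B v_i| <= gamma_i / 2. At that distance at least half of the slack of
    every inequality of the cell is left, so under d_u each vertex v_k costs at
    least Delta_i more than v_i, except those with B v_k = B v_i and
    c . v_k = c . v_i ([Delta_le]). The hull of the latter consists of minimizers
    of f.

    It remains to estimate how much weight x puts on the other vertices. Splitting
    x = (1 - t) y + t z between the two groups ([polytope_hull], [hull_split]),
    the weight t costs at least t Delta_i and gains an entropy of at most
    t R_H + R_1 (t + t ln (1 / t)) ([rentropy_mix]), so that optimality forces
    t <= exp (- Delta_i / (eps R_1) + (R_1 + R_H) / R_1)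
    ([entropic_weight_le]), and the distance of x to y is at most 2 R_1 t. *)

(** * Inner products and norms *)

Section InnerProduct.
Context {R : realType} {n : nat}.
Implicit Types (x y z : 'cV[R]_n) (a : R).

Lemma dotvE x y : dotv x y = \sum_i x i 0 * y i 0.
Proof. by rewrite /dotv mxE; apply: eq_bigr => i _; rewrite mxE. Qed.

Lemma dotvC x y : dotv x y = dotv y x.
Proof. by rewrite !dotvE; apply: eq_bigr => i _; rewrite mulrC. Qed.

Lemma dotvDr x y z : dotv x (y + z) = dotv x y + dotv x z.
Proof. by rewrite /dotv mulmxDr mxE. Qed.

Lemma dotvNr x y : dotv x (- y) = - dotv x y.
Proof. by rewrite /dotv mulmxN mxE. Qed.

Lemma dotvZr a x y : dotv x (a *: y) = a * dotv x y.
Proof. by rewrite /dotv -scalemxAr mxE. Qed.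

Lemma dotvBr x y z : dotv x (y - z) = dotv x y - dotv x z.
Proof. by rewrite dotvDr dotvNr. Qed.

Lemma dotvBl x y z : dotv (y - z) x = dotv y x - dotv z x.
Proof. by rewrite dotvC dotvBr !(dotvC x). Qed.

Lemma dotv0r x : dotv x 0 = 0.
Proof. by rewrite /dotv mulmx0 mxE. Qed.

Lemma dotv_sumr (I : Type) (s : seq I) x (F : I -> 'cV[R]_n) :
  dotv x (\sum_(k <- s) F k) = \sum_(k <- s) dotv x (F k).
Proof. by rewrite /dotv mulmx_sumr summxE. Qed.

Lemma dotvv_ge0 x : 0 <= dotv x x.
Proof. by rewrite dotvE sumr_ge0// => i _; rewrite -expr2 sqr_ge0. Qed.

Lemma dotvv_eq0 x : (dotv x x == 0) = (x == 0).
Proof.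
apply/eqP/eqP => [|->]; last by rewrite dotv0r.
rewrite dotvE => /eqP; rewrite psumr_eq0 => [/allP x0|i _]; last first.
  by rewrite -expr2 sqr_ge0.
apply/matrixP => i j; rewrite ord1 mxE.
by have := x0 i (mem_index_enum _); rewrite mulf_eq0 orbb => /eqP.
Qed.

Lemma sqr_l2norm x : l2norm x ^+ 2 = dotv x x.
Proof.
rewrite /l2norm sqr_sqrtr ?dotvE; last by apply: sumr_ge0 => i _; exact: sqr_ge0.
by apply: eq_bigr => i _; rewrite expr2.
Qed.

Lemma l2norm_ge0 x : 0 <= l2norm x.
Proof. exact: sqrtr_ge0. Qed.

Lemma l2norm_eq0 x : (l2norm x == 0) = (x == 0).
Proof. by rewrite -dotvv_eq0 -sqr_l2norm sqrf_eq0. Qed.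

Lemma l2norm0 : l2norm (0 : 'cV[R]_n) = 0.
Proof. by apply/eqP; rewrite l2norm_eq0. Qed.

Lemma l2normZ a x : 0 <= a -> l2norm (a *: x) = a * l2norm x.
Proof.
move=> a0; apply/eqP; rewrite -(@eqrXn2 _ 2) ?l2norm_ge0 ?mulr_ge0 ?l2norm_ge0//.
by rewrite exprMn !sqr_l2norm dotvZr dotvC dotvZr mulrA expr2.
Qed.

Lemma l2normBC x y : l2norm (x - y) = l2norm (y - x).
Proof.
congr Num.sqrt; apply: eq_bigr => i _; rewrite !mxE.
by rewrite -sqrrN opprB.
Qed.

Lemma cauchy_schwarz x y : dotv x y <= l2norm x * l2norm y.
Proof.
apply: le_trans (ler_norm _) _.
rewrite -ler_sqr ?nnegrE ?mulr_ge0 ?l2norm_ge0// real_normK ?num_real//.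
rewrite exprMn !sqr_l2norm.
have [->|y0] := eqVneq y 0; first by rewrite !dotv0r expr0n/= mulr0.
have yy : 0 < dotv y y by rewrite lt_def dotvv_eq0 y0 dotvv_ge0.
have := dotvv_ge0 (dotv y y *: x - dotv x y *: y).
rewrite !(dotvBr, dotvBl, dotvZr) !(dotvC (_ *: _)) !dotvZr (dotvC y x).
move=> h; rewrite -subr_ge0 -(pmulr_rge0 _ yy); apply: le_trans h _.
by rewrite le_eqVlt; apply/orP; left; apply/eqP; ring.
Qed.

Lemma l2norm_le_l1norm x : l2norm x <= l1norm x.
Proof.
have l1 : 0 <= l1norm x by rewrite sumr_ge0.
rewrite -ler_sqr ?nnegrE ?l2norm_ge0// sqr_l2norm dotvE expr2.
rewrite {1}/l1norm mulr_suml ler_sum// => i _.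
rewrite -expr2 -(real_normK (num_real _)) expr2 ler_wpM2l//.
by rewrite /l1norm (bigD1 i)//= lerDl sumr_ge0.
Qed.

Lemma l1normB x y : l1norm (x - y) <= l1norm x + l1norm y.
Proof.
by rewrite -big_split ler_sum// => i _; rewrite !mxE ler_normB.
Qed.

Lemma dotv_continuous x : continuous (dotv x).
Proof.
have -> : dotv x = fun z => \sum_i x i 0 * z i 0.
  by apply/funext => z; rewrite dotvE.
apply: continuous_big => [|i _ y]; first exact: add_continuous.
have yi : (z : 'cV[R]_n) i 0 @[z --> y] --> y i 0 by exact: coord_continuous.
exact: cvgMl_tmp yi.
Qed.

End InnerProduct.

Lemma dotv_trmx (R : realType) (m n : nat) (B : 'M[R]_(m, n)) u x :
  dotv (B^T *m u) x = dotv u (B *m x).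
Proof. by rewrite /dotv trmx_mul trmxK mulmxA. Qed.

(** * Convex hulls and polytopes *)

Section ConvexHull.
Context {R : realType} {n V : nat}.
Variable v : 'I_V -> 'cV[R]_n.

Definition hull (P : pred 'I_V) : set 'cV[R]_n :=
  [set x | exists l : 'I_V -> R, [/\ forall k, 0 <= l k,
     forall k, ~~ P k -> l k = 0, \sum_k l k = 1 & x = \sum_k l k *: v k]].

Lemma hull_point (P : pred 'I_V) k : P k -> hull P (v k).
Proof.
move=> Pk; exists (fun j => (j == k)%:R); split => [j|j|  |].
- by rewrite ler0n.
- by case: eqVneq => // ->; rewrite Pk.
- by rewrite (bigD1 k)//= eqxx big1 ?addr0// => j /negbTE ->.
- rewrite (bigD1 k)//= eqxx scale1r big1 ?addr0// => j /negbTE ->.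
  by rewrite scale0r.
Qed.

Lemma hull_convex (P : pred 'I_V) x y (t : R) : 0 <= t <= 1 ->
  hull P x -> hull P y -> hull P (t *: x + (1 - t) *: y).
Proof.
move=> /andP[t0 t1] [l [l0 lP l1 ->]] [l' [l'0 l'P l'1 ->]].
exists (fun k => t * l k + (1 - t) * l' k); split => [k|k Pk|  |].
- by rewrite addr_ge0 ?mulr_ge0 ?subr_ge0.
- by rewrite lP// l'P// !mulr0 addr0.
- by rewrite big_split/= -!mulr_sumr l1 l'1; ring.
- rewrite !scaler_sumr -big_split/=; apply: eq_bigr => k _.
  by rewrite !scalerA -scalerDl.
Qed.

Lemma hull_dotv_ge (P : pred 'I_V) d (a : R) x :
  (forall k, P k -> a <= dotv d (v k)) -> hull P x -> a <= dotv d x.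
Proof.
move=> da [l [l0 lP l1 ->]]; rewrite dotv_sumr -[a]mul1r -l1 mulr_suml.
rewrite ler_sum// => k _; rewrite dotvZr; have [Pk|nPk] := boolP (P k).
  by rewrite ler_wpM2l ?da.
by rewrite lP// !mul0r.
Qed.

Lemma hull_dotv_eq (P : pred 'I_V) d (a : R) x :
  (forall k, P k -> dotv d (v k) = a) -> hull P x -> dotv d x = a.
Proof.
move=> da [l [l0 lP l1 ->]]; rewrite dotv_sumr -[a]mul1r -l1 mulr_suml.
apply: eq_bigr => k _; rewrite dotvZr; have [Pk|nPk] := boolP (P k).
  by rewrite da.
by rewrite lP// !mul0r.
Qed.

Lemma hull_mulmx (r : nat) (B : 'M[R]_(r, n)) (P : pred 'I_V) a x :
  (forall k, P k -> B *m v k = a) -> hull P x -> B *m x = a.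
Proof.
move=> da [l [l0 lP l1 ->]]; rewrite mulmx_sumr -[a]scale1r -l1 scaler_suml.
apply: eq_bigr => k _; rewrite -scalemxAr; have [Pk|nPk] := boolP (P k).
  by rewrite da.
by rewrite lP// !scale0r.
Qed.

(** Grouping the weights of a convex combination into those that P selects and
    the others. The first alternative is kept apart because the second group can
    be empty; the first one cannot, by the point v i. *)
Lemma hull_split (P : pred 'I_V) i x : P i -> hull xpredT x ->
  hull P x \/ exists t y z, [/\ 0 < t <= 1, hull P y, hull (predC P) z &
    x = (1 - t) *: y + t *: z].
Proof.
move=> Pi [l [l0 _ l1 xE]]; pose t := \sum_(k | ~~ P k) l k.
have tE : \sum_(k | P k) l k = 1 - t.
  by apply/eqP; rewrite eq_sym subr_eq -l1 (bigID P)/=.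
have t_ge0 : 0 <= t by rewrite sumr_ge0.
have t_le1 : t <= 1 by rewrite -subr_ge0 -tE sumr_ge0.
(* Normalization of a group Q of weights of total mass s, used for P and predC P. *)
have norm (Q : pred 'I_V) (s : R) : s = \sum_(k | Q k) l k -> s != 0 ->
    hull Q (s^-1 *: \sum_(k | Q k) l k *: v k).
  move=> sE s0; exists (fun k => if Q k then s^-1 * l k else 0); split.
  - move=> k; case: ifP => // _; rewrite mulr_ge0// invr_ge0 sE.
    by rewrite sumr_ge0.
  - by move=> k /negbTE ->.
  - by rewrite -big_mkcond/= -mulr_sumr -sE mulVf.
  - rewrite scaler_sumr big_mkcond/=; apply: eq_bigr => k _.
    by case: ifP => _; rewrite ?scale0r ?scalerA.
have xE' : x = \sum_(k | P k) l k *: v k + \sum_(k | ~~ P k) l k *: v k.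
  by rewrite xE (bigID P)/=.
have [t0|t0] := eqVneq t 0.
  left; have := norm P 1; rewrite tE t0 subr0 oner_eq0 invr1 scale1r.
  suff -> : \sum_(k | P k) l k *: v k = x by apply.
  rewrite xE' [X in _ + X]big1 ?addr0// => k Pk.
  have /eqP := t0; rewrite psumr_eq0// => /allP/(_ k (mem_index_enum _)).
  by rewrite Pk/= => /eqP ->; rewrite scale0r.
right; have t_gt0 : 0 < t by rewrite lt_def t0.
have hz := norm (predC P) t erefl t0.
have [t1|t1] := eqVneq t 1.
  (* No weight on P: the coefficient of the P part is 0 and v i fills its place. *)
  exists t, (v i), (t^-1 *: \sum_(k | ~~ P k) l k *: v k).
  split => //; [by rewrite t_gt0|exact: hull_point|].
  rewrite scalerA divff// scale1r {1}t1 subrr scale0r add0r xE'.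
  rewrite [X in X + _]big1 ?add0r// => k Pk.
  have /eqP := tE; rewrite t1 subrr psumr_eq0//.
  by move=> /allP/(_ k (mem_index_enum _)); rewrite Pk/= => /eqP ->; rewrite scale0r.
have t1' : 1 - t != 0 by rewrite subr_eq0 eq_sym.
exists t, ((1 - t)^-1 *: \sum_(k | P k) l k *: v k),
  (t^-1 *: \sum_(k | ~~ P k) l k *: v k).
split => //; [by rewrite t_gt0|exact: norm|].
by rewrite !scalerA !divff// !scale1r.
Qed.

End ConvexHull.

Section Polyhedron.
Context {R : realType} {m n : nat} (A : 'M[R]_(m, n)) (b : 'cV[R]_m).
Local Notation K := (polyhedron A b).

Lemma hull_sub_polyhedron V (v : 'I_V -> 'cV[R]_n) P :
  (forall k, K (v k)) -> hull v P `<=` K.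
Proof.
move=> Kv x [l [l0 lP l1 ->]]; split=> [|i].
  rewrite mulmx_sumr -[b]scale1r -l1 scaler_suml.
  by apply: eq_bigr => k _; rewrite -scalemxAr (Kv k).1.
rewrite summxE sumr_ge0// => k _; rewrite mxE mulr_ge0//.
exact: (Kv k).2.
Qed.

Definition supp (x : 'cV[R]_n) : {set 'I_n} := [set i | x i 0 != 0]%SET.

(** Walking from x along a direction of the face of x that leaves the orthant,
    until a first coordinate vanishes. *)
Lemma shrink_support x w : K x -> A *m w = 0 -> supp w \subset supp x ->
  (exists i, w i 0 < 0) ->
  exists s, [/\ 0 < s, K (x + s *: w) & (#|supp (x + s *: w)%R| < #|supp x|)%N].
Proof.
move=> [Ax x0] Aw wx [i0 wi0].
have [j wj minj] := @arg_minP _ _ _ i0 [pred i | w i 0 < 0]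
  (fun i => x i 0 / - w i 0) wi0.
have xj : 0 < x j 0.
  rewrite lt_def x0 andbT; have := fintype.subsetP wx j.
  by rewrite !inE; apply; rewrite lt_eqF.
(* The ratio test of the simplex method. *)
pose s := x j 0 / - w j 0.
have s0 : 0 < s by rewrite divr_gt0// oppr_gt0.
exists s; split => //.
  split=> [|i]; first by rewrite mulmxDr -scalemxAr Aw scaler0 addr0.
  rewrite !mxE; have [wi|wi] := ltP (w i 0) 0; last first.
    by rewrite addr_ge0// mulr_ge0// ltW.
  by have := minj _ wi; rewrite ler_pdivlMr ?oppr_gt0// -/s mulrN; lra.
apply: fintype.proper_card; apply/fintype.properP; split.
  apply/fintype.subsetP => i; rewrite !inE !mxE; apply: contraNN => /eqP xi.
  have : i \notin supp w.
    by apply/negP => /(fintype.subsetP wx); rewrite inE xi eqxx.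
  by rewrite inE negbK => /eqP ->; rewrite xi mulr0 addr0.
exists j; first by rewrite inE gt_eqF.
rewrite inE !mxE negbK /s; apply/eqP.
by field; rewrite lt_eqF.
Qed.

Hypothesis K_bounded : bounded_set K.

Lemma bounded_polyhedron_coord : exists a, forall x i, K x -> x i 0 <= a.
Proof.
have [a [_ Ka]] := K_bounded; exists (a + 1) => x i Kx.
apply: le_trans (Ka (a + 1) _ _ Kx); last by rewrite ltrDl.
apply: le_trans (ler_norm _) _.
rewrite /Num.norm/= mx_normE.
change ((`|x i 0|%:nng)%:num <= (\big[Order.max/0%:nng]_(ij : 'I_n * 'I_1)
  `|x ij.1 ij.2|%:nng)%:num); rewrite num_le.
exact: (le_bigmax _ (fun ij : 'I_n * 'I_1 => `|x ij.1 ij.2|%:nng) (i, 0)).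
Qed.

(** Otherwise the whole ray from x in direction w stays in K. *)
Lemma recession_direction_neg x (w : 'cV[R]_n) : K x -> A *m w = 0 -> w != 0 ->
  exists i, w i 0 < 0.
Proof.
move=> [Ax x0] Aw w0; apply: contrapT => nw.
have wge i : 0 <= w i 0 by rewrite leNgt; apply/negP => wi; apply: nw; exists i.
have [i wi] : exists i, 0 < w i 0.
  apply: contrapT => nw'; move/eqP: w0; apply; apply/matrixP => i j.
  rewrite ord1 mxE; apply/eqP; rewrite eq_le wge andbT leNgt.
  by apply/negP => wi; apply: nw'; exists i.
have [a Ka] := bounded_polyhedron_coord.
have a0 : 0 <= a by apply: le_trans (Ka x i _).
(* With this step the i-th coordinate of x + s w exceeds the bound a. *)
pose s := (a + 1) / w i 0.
have s0 : 0 <= s by rewrite divr_ge0// ?addr_ge0.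
have : K (x + s *: w).
  split=> [|k]; first by rewrite mulmxDr -scalemxAr Aw scaler0 addr0.
  by rewrite !mxE addr_ge0// mulr_ge0.
move=> /Ka - /(_ i); rewrite !mxE /s divfK ?gt_eqF//.
by have := x0 i; lra.
Qed.

(** Minkowski's theorem for polytopes, by induction on the support: through a
    point that is not a vertex runs a line of its face, and both ends of that
    line in K have a smaller support. *)
Lemma polytope_hull V (v : 'I_V -> 'cV[R]_n) x :
  vertices K `<=` range v -> K x -> hull v xpredT x.
Proof.
move=> vK; have [N] := ubnP #|supp x|.
elim: N x => // N IH x xN Kx.
have [/vK [k _ <-]|nv] := pselect (vertices K x); first exact: hull_point.
have [y [z [t [Ky Kz /andP[t0 t1] xE yz]]]] : exists y z t, [/\ K y, K z,
    0 < t < 1, x = t *: y + (1 - t) *: z & y - z != 0].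
  apply: contrapT => nyz; apply: nv; split=> // y z t Ky Kz t01 xE.
  have [yz|yz] := eqVneq (y - z) 0; last by exfalso; apply: nyz; exists y, z, t.
  move: yz xE => /eqP; rewrite subr_eq0 => /eqP ->.
  by rewrite -scalerDl addrC subrK scale1r.
pose w := y - z.
have Aw : A *m w = 0 by rewrite mulmxBr Ky.1 Kz.1 subrr.
have wx : supp w \subset supp x.
  apply/fintype.subsetP => i; rewrite !inE xE !mxE; apply: contraNN => /eqP.
  have := Ky.2 i; have := Kz.2 i => z0 y0 /eqP.
  rewrite paddr_eq0 ?mulr_ge0 ?subr_ge0 ?(ltW t0) ?(ltW t1)//.
  rewrite !mulf_eq0 (gt_eqF t0) subr_eq0 (gt_eqF t1)/=.
  by move=> /andP[/eqP -> /eqP ->]; rewrite subrr.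
have nw : - w != 0 by rewrite oppr_eq0.
have Anw : A *m - w = 0 by rewrite mulmxN Aw oppr0.
have nwx : supp (- w) \subset supp x.
  apply: fintype.subset_trans wx; apply/fintype.subsetP => i.
  by rewrite !inE !mxE oppr_eq0.
have [s [s0 Ks /leq_trans/(_ xN) cs]] :=
  shrink_support Kx Aw wx (recession_direction_neg Kx Aw yz).
have [s' [s'0 Ks' /leq_trans/(_ xN) cs']] :=
  shrink_support Kx Anw nwx (recession_direction_neg Kx Anw nw).
have -> : x = (s' / (s + s')) *: (x + s *: w)
              + (1 - s' / (s + s')) *: (x + s' *: - w).
  apply/matrixP => i j; rewrite !mxE; field.
  by rewrite gt_eqF// addr_gt0.
apply: hull_convex; [|exact: IH|exact: IH].
by rewrite divr_ge0 ?addr_ge0 ?(ltW s0) ?(ltW s'0)//= ler_pdivrMr ?addr_gt0//;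
  lra.
Qed.

End Polyhedron.

(** * Distance to the boundary of an intersection of half-spaces *)

Section HalfspaceIntersection.
Context {R : realType} {r : nat} {I : finType}.
Variables (w : I -> 'cV[R]_r) (s : I -> R) (p : 'cV[R]_r).
Hypothesis s_ge0 : forall k, 0 <= s k.
Let S : set 'cV[R]_r := [set u | forall k, dotv (w k) (u - p) <= s k].

(** A constraint with a zero normal does not depend on u, and no constraint with a
    nonzero normal is tight at a point closer to p than its hyperplane. *)
Lemma dist_bd_ge rho : (forall k, rho * l2norm (w k) <= s k) ->
  (rho%:E <= dist p (bd S))%E.
Proof.
move=> rho_le; apply: le_ereal_inf_tmp => _ [y [_ yS] <-]; rewrite lee_fin.
rewrite leNgt; apply/negP => yp; apply: yS.
suff : \forall u \near y, forall k, dotv (w k) (u - p) <= s k by [].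
apply: (@filter_forall _ I (fun k u => dotv (w k) (u - p) <= s k) (nbhs y)) => k.
have [wk0|wk0] := eqVneq (w k) 0.
  by apply: nearW => u; rewrite wk0 dotvC dotv0r.
have wy : dotv (w k) y < s k + dotv (w k) p.
  rewrite -ltrBlDr -dotvBr; apply: le_lt_trans (cauchy_schwarz _ _) _.
  apply: lt_le_trans (rho_le k); rewrite mulrC ltr_pM2r ?(l2normBC y)//.
  by rewrite lt_def l2norm_eq0 wk0 l2norm_ge0.
have nw : \forall u \near y, dotv (w k) u < s k + dotv (w k) p.
  exact: (@dotv_continuous _ _ (w k) y _ (lt_nbhsl wy)).
apply: filterS nw => u uw.
by rewrite dotvBr lerBlDr ltW.
Qed.

(** The nearest of the hyperplanes, that of j, carries a boundary point: the
    projection y of p onto it satisfies the other constraints because their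
    hyperplanes are not closer to p. *)
Lemma dist_bd_le k : w k != 0 ->
  (dist p (bd S) <= (s k / l2norm (w k))%:E)%E.
Proof.
move=> wk0; have [j wj0 minj] := @arg_minP _ _ _ k [pred i | w i != 0]
  (fun i => s i / l2norm (w i)) wk0; rewrite /= in wj0.
apply: le_trans (_ : ((s j / l2norm (w j))%:E <= _)%E); last first.
  by rewrite lee_fin minj.
have nj : 0 < l2norm (w j) by rewrite lt_def l2norm_eq0 wj0 l2norm_ge0.
pose a := s j / l2norm (w j) ^+ 2; pose y := p + a *: w j.
have a0 : 0 <= a by rewrite divr_ge0 ?exprn_ge0 ?s_ge0 ?l2norm_ge0.
have aE : a * l2norm (w j) = s j / l2norm (w j).
  by rewrite /a; field; rewrite gt_eqF.
have Sy : S y.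
  move=> i; rewrite /y [_ - p]addrC addKr dotvZr.
  have [->|wi0] := eqVneq (w i) 0; first by rewrite dotvC dotv0r mulr0.
  have ni : 0 < l2norm (w i) by rewrite lt_def l2norm_eq0 wi0 l2norm_ge0.
  apply: le_trans (ler_wpM2l a0 (cauchy_schwarz _ _)) _.
  by rewrite mulrCA aE mulrC -ler_pdivlMr// minj.
have -> : s j / l2norm (w j) = l2norm (p - y).
  by rewrite l2normBC /y [_ - p]addrC addKr l2normZ.
apply: ereal_inf_lbound; exists y => //; split; first exact: subset_closure.
rewrite /interior => nSy.
(* Crossing the hyperplane of j at its point y leaves S. *)
have cvy : (y + t *: w j) @[t --> (0 : R)] --> y.
  have cw : t *: w j @[t --> (0 : R)] --> 0 *: w j.
    by apply: cvgZr_tmp; exact: cvg_id.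
  rewrite -[X in _ --> X]addr0 -(scale0r (w j)).
  by apply: cvgD => //; exact: cvg_cst.
have /nbhs_ballP[e /= e0 He] := cvy _ nSy.
have /He : ball (0 : R) e (e / 2).
  rewrite /ball/= sub0r normrN gtr0_norm ?divr_gt0// ltr_pdivrMr//.
  by rewrite mulr_natr mulr2n ltrDl.
move=> /(_ j); rewrite /y -[p + _ + _]addrA [_ - p]addrC addKr.
rewrite dotvDr !dotvZr -sqr_l2norm.
rewrite /a divfK ?gt_eqF ?exprn_gt0// gerDl.
by rewrite leNgt mulr_gt0 ?divr_gt0 ?exprn_gt0.
Qed.

End HalfspaceIntersection.

(** * Entropy of convex combinations *)

Section Entropy.
Context {R : realType}.

Definition negxlnx (t : R) : R := - (t * ln t).

Lemma negxlnx0 : negxlnx 0 = 0.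
Proof. by rewrite /negxlnx mul0r oppr0. Qed.

Lemma ln_le_subr1 (t : R) : 0 < t -> ln t <= t - 1.
Proof. by move=> t0; rewrite -{1}(subrKC 1 t) le_ln1Dx//; lra. Qed.

Lemma negxlnx_le (t : R) : 0 <= t -> negxlnx t <= 1 - t.
Proof.
rewrite le_eqVlt => /predU1P[<-|t0]; first by rewrite negxlnx0 subr0.
have := ln_le_subr1 (_ : 0 < t^-1); rewrite invr_gt0 => /(_ t0).
rewrite lnV ?posrE// -(ler_pM2l t0) mulrBr divff ?gt_eqF// mulr1 mulrN.
by rewrite /negxlnx.
Qed.

Lemma negxlnx_ge (t : R) : 0 <= t -> t - t ^+ 2 <= negxlnx t.
Proof.
rewrite le_eqVlt => /predU1P[<-|t0]; first by rewrite negxlnx0 expr0n subr0.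
by have := ln_le_subr1 t0; rewrite -(ler_pM2l t0) /negxlnx; nra.
Qed.

Lemma negxlnx_ge0 (t : R) : 0 <= t <= 1 -> 0 <= negxlnx t.
Proof.
move=> /andP[t0 t1]; apply: le_trans (negxlnx_ge t0).
by rewrite expr2 -{1}[t]mulr1 -mulrBr mulr_ge0 ?subr_ge0.
Qed.

Lemma negxlnxD (a b : R) : 0 <= a -> 0 <= b ->
  negxlnx (a + b) <= negxlnx a + negxlnx b.
Proof.
rewrite le_eqVlt => /predU1P[<- _|a0]; first by rewrite negxlnx0 !add0r.
rewrite le_eqVlt => /predU1P[<-|b0]; first by rewrite negxlnx0 !addr0.
rewrite /negxlnx mulrDl opprD lerD// lerN2 ler_pM2l// ler_ln ?posrE ?addr_gt0//.
- by rewrite lerDl ltW.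
- by rewrite lerDr ltW.
Qed.

Lemma negxlnxM (a b : R) : 0 <= a -> 0 <= b ->
  negxlnx (a * b) = a * negxlnx b + b * negxlnx a.
Proof.
rewrite le_eqVlt => /predU1P[<- _|a0].
  by rewrite !(mul0r, negxlnx0) mulr0 addr0.
rewrite le_eqVlt => /predU1P[<-|b0].
  by rewrite !(mul0r, mulr0, negxlnx0) addr0.
by rewrite /negxlnx lnM ?posrE//; ring.
Qed.

Context {n : nat}.
Implicit Types x y z : 'cV[R]_n.

Definition rentropy x : R := \sum_i negxlnx (x i 0).

Lemma entropyE x : (forall i, 0 <= x i 0) -> entropy x = (rentropy x)%:E.
Proof.
move=> x0; rewrite /entropy; case: ifPn => [_|/forallPn[i /negP]].
  by rewrite /rentropy -sumrN.
by case.
Qed.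

Lemma l1norm_nonneg x : (forall i, 0 <= x i 0) -> l1norm x = \sum_i x i 0.
Proof. by move=> x0; apply: eq_bigr => i _; rewrite ger0_norm. Qed.

Lemma rentropy_le x : (forall i, 0 <= x i 0) -> rentropy x <= n%:R.
Proof.
move=> x0; rewrite -[n in n%:R]card_ord -sumr_const ler_sum// => i _.
by apply: le_trans (negxlnx_le (x0 i)) _; rewrite gerBl.
Qed.

Lemma rentropy_ge x : (forall i, 0 <= x i 0) -> - l1norm x ^+ 2 <= rentropy x.
Proof.
move=> x0; have S0 : 0 <= \sum_i x i 0 by exact: sumr_ge0.
rewrite l1norm_nonneg// expr2 {1}mulr_suml -sumrN ler_sum// => i _.
apply: le_trans (negxlnx_ge (x0 i)); have xi := x0 i.
have : x i 0 <= \sum_i x i 0 by rewrite (bigD1 i)//= lerDl sumr_ge0.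
by nra.
Qed.

(** Mixing costs little entropy: besides the entropies of the two parts, only
    the binary entropy of the mixing weights appears, scaled by the mass. *)
Lemma rentropy_mix x y z (t a : R) : 0 <= t <= 1 ->
  (forall i, 0 <= y i 0) -> (forall i, 0 <= z i 0) ->
  l1norm y <= a -> l1norm z <= a -> x = (1 - t) *: y + t *: z ->
  rentropy x - rentropy y <=
    t * (rentropy z - rentropy y) + a * (negxlnx t + t).
Proof.
move=> t01 y0 z0 ya za xE; have /andP[t0 t1] := t01.
have ct0 : 0 <= 1 - t by rewrite subr_ge0.
have bx : rentropy x <= (1 - t) * rentropy y + t * rentropy z
    + l1norm y * negxlnx (1 - t) + l1norm z * negxlnx t.
  rewrite !l1norm_nonneg// !mulr_sumr !mulr_suml -!big_split/= ler_sum// => i _.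
  rewrite xE !mxE; apply: le_trans (negxlnxD _ _) _; rewrite ?mulr_ge0//.
  by rewrite !negxlnxM//; lra.
have h1 : l1norm y * negxlnx (1 - t) <= a * t.
  rewrite ler_pM//; first by rewrite l1norm_nonneg// sumr_ge0.
    by rewrite negxlnx_ge0// ct0 gerBl.
  by apply: le_trans (negxlnx_le ct0) _; rewrite subKr.
have h2 : l1norm z * negxlnx t <= a * negxlnx t.
  by rewrite ler_wpM2r// negxlnx_ge0.
by lra.
Qed.

(** If x mixes a mass t of points whose linear cost exceeds by D the cost of the
    rest, the cost t * D that x pays has to be compensated by the entropy gained,
    which is of order eps * t * ln (1 / t). Hence t is exponentially small. *)
Lemma entropic_weight_le d x y z (t a h D eps : R) :
  0 < t <= 1 -> 0 < a -> 0 < eps ->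
  (forall i, 0 <= y i 0) -> (forall i, 0 <= z i 0) ->
  l1norm y <= a -> l1norm z <= a -> rentropy z - rentropy y <= h ->
  x = (1 - t) *: y + t *: z -> D <= dotv d z - dotv d y ->
  dotv d x - eps * rentropy x <= dotv d y - eps * rentropy y ->
  t <= expR (- D / (eps * a) + (a + h) / a).
Proof.
move=> /andP[t0 t1] a0 e0 y0 z0 ya za zyh xE gap opt.
have mix := @rentropy_mix x y z t a _ y0 z0 ya za xE.
have {mix} : rentropy x - rentropy y <= t * (h + a - a * ln t).
  apply: le_trans (mix _) _; first by rewrite ltW.
  have : t * (rentropy z - rentropy y) <= t * h by rewrite ler_pM2l.
  rewrite /negxlnx.
  by lra.
rewrite -(ler_pM2l e0) => ent.
have : t * D <= eps * (t * (h + a - a * ln t)).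
  apply: le_trans ent; apply: le_trans (_ : dotv d x - dotv d y <= _); last by lra.
  rewrite xE dotvDr !dotvZr.
  have : t * D <= t * (dotv d z - dotv d y) by rewrite ler_pM2l.
  by lra.
rewrite mulrCA ler_pM2l// => {}ent.
rewrite -[leLHS]lnK ?posrE// ler_expR.
rewrite -(ler_pM2l (mulr_gt0 e0 a0)).
have -> : eps * a * (- D / (eps * a) + (a + h) / a) = - D + eps * (a + h).
  by field; rewrite !gt_eqF.
by lra.
Qed.

End Entropy.

(** * Infima and suprema of extended reals *)

Lemma ereal_inf_minimum {R : realType} {T : Type} (D : set T) (F : T -> \bar R) x :
  D x -> (forall y, D y -> (F x <= F y)%E) -> ereal_inf [set F y | y in D] = F x.
Proof.
move=> Dx Fx; apply/eqP; rewrite eq_le; apply/andP; split.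
  by apply: ereal_inf_lbound; exists x.
by apply: le_ereal_inf_tmp => _ [y Dy <-]; exact: Fx.
Qed.

(** The infimum is attained, or is +oo when D is empty. *)
Lemma ereal_inf_gt0_finite {R : realType} {I : finType} (D : set I)
    (F : I -> \bar R) :
  (forall i, D i -> (0 < F i)%E) -> (0 < ereal_inf [set F i | i in D])%E.
Proof.
move=> F0; have [[i0 Di0]|D0] := pselect (D !=set0); last first.
  suff -> : [set F i | i in D] = set0 by rewrite ereal_inf0.
  by rewrite -subset0 => y [i Di _]; apply: D0; exists i.
have [i Di mini] : exists2 i, D i & forall j, D j -> (F i <= F j)%E.
  case: (@arg_minP _ _ _ i0 (fun i => `[< D i >]) F (asboolT Di0)) => i Di mini.
  by exists i => [|j Dj]; [exact/asboolP|exact/mini/asboolP].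
by rewrite (ereal_inf_minimum Di) ?F0.
Qed.

Lemma ereal_sup_fin {R : realType} (S : set (\bar R)) (a : R) : S !=set0 ->
  (forall y, S y -> exists2 t : R, y = t%:E & t <= a) ->
  exists s : R, ereal_sup S = s%:E /\ forall t : R, S t%:E -> t <= s.
Proof.
move=> [y0 Sy0] Sa; have [t0 yt _] := Sa _ Sy0.
have up : (ereal_sup S <= a%:E)%E.
  by apply: ge_ereal_sup => y /Sa[t ->]; rewrite lee_fin.
have low y : S y -> (y <= ereal_sup S)%E by move=> Sy; exact: ereal_sup_ubound.
move: up (low) (low _ Sy0); rewrite yt.
case: (ereal_sup S) => [s| |]// _ {}low _; exists s; split => // t /low.
by rewrite lee_fin.
Qed.

(** Over h = 0 the quotient is +oo and bounds nothing, but then e * h = 0. *)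
Lemma lt_div_nneg_ereal {R : realType} (e h : R) (y : \bar R) :
  0 <= h -> (0 < y)%E -> (e%:E < y / h%:E)%E -> ((e * h)%:E < y)%E.
Proof.
rewrite le_eqVlt => /predU1P[<-|h0] y0; first by rewrite mulr0.
by rewrite inver gt_eqF// lte_pdivlMr.
Qed.

(** * The dual function on the cells *)

Section Dual.
Context {R : realType} {m n r V : nat}.
Variables (A : 'M[R]_(m, n)) (b : 'cV[R]_m) (c : 'cV[R]_n) (B : 'M[R]_(r, n)).
Variable v : 'I_V -> 'cV[R]_n.
Local Notation K := (polyhedron A b).
Local Notation cost u := (c - B^T *m u).
Local Notation f := (objective (B^T *m B) c).

Lemma cost_dotv u x : dotv (cost u) x = dotv c x - dotv u (B *m x).
Proof. by rewrite dotvBl dotv_trmx. Qed.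

(** Completing the square in the quadratic Fenchel duality
    - |Bx|^2 / 2 = min_u (|u|^2 / 2 - u.Bx). *)
Lemma linearized_objective u x :
  2^-1 * l2norm u ^+ 2 + dotv (cost u) x =
  2^-1 * l2norm (u - B *m x) ^+ 2 + f x.
Proof.
rewrite /objective cost_dotv !sqr_l2norm dotvBr !dotvBl -mulmxA.
rewrite [dotv x (B^T *m _)]dotvC dotv_trmx (dotvC (B *m x) u); lra.
Qed.

Hypothesis K_bounded : bounded_set K.
Hypothesis v_vertices : range v = vertices K.

Lemma vertex_in_K i : K (v i).
Proof. by have [] : vertices K (v i) by rewrite -v_vertices; exists i. Qed.

Lemma K_hull x : K x -> hull v xpredT x.
Proof. by apply: polytope_hull => //; rewrite v_vertices. Qed.

Lemma cell_min i u x : cell c B v i u -> K x ->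
  dotv (cost u) (v i) <= dotv (cost u) x.
Proof.
move=> iu /K_hull; apply: hull_dotv_ge => k _.
by have [->//|ki] := eqVneq k i; exact: iu.
Qed.

Lemma cell_cover u : K !=set0 -> exists i, cell c B v i u.
Proof.
move=> [x /K_hull[l [_ _ l1 _]]].
have [i0] : exists i : 'I_V, True.
  apply: contrapT => nV; move: l1; rewrite big1 => [/eqP|i _].
    by rewrite eq_sym oner_eq0.
  by exfalso; apply: nV; exists i.
have [i _ mini] := @arg_minP _ _ _ i0 xpredT (fun i => dotv (cost u) (v i)) isT.
by exists i => j _; exact: mini.
Qed.

Lemma best_vertex : K !=set0 -> exists i, forall x, K x -> f (v i) <= f x.
Proof.
move=> K0; have [i0 _] := cell_cover 0 K0.
have [i _ mini] := @arg_minP _ _ _ i0 xpredT (fun i => f (v i)) isT.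
exists i => x Kx; have [j /cell_min/(_ Kx)] := cell_cover (B *m x) K0.
rewrite -(lerD2l (2^-1 * l2norm (B *m x) ^+ 2)) !linearized_objective subrr.
rewrite l2norm0 expr0n mulr0 add0r => fj; apply: le_trans (mini j isT) _.
by apply: le_trans fj; rewrite lerDr mulr_ge0// ?invr_ge0 ?sqr_ge0.
Qed.

Lemma gfun0_cell i u : cell c B v i u ->
  gfun K c B 0 u = (2^-1 * l2norm (u - B *m v i) ^+ 2 + f (v i))%:E.
Proof.
move=> iu; rewrite /gfun (_ : ereal_inf _ = (dotv (cost u) (v i))%:E).
  by rewrite -EFinD linearized_objective.
rewrite -(ereal_inf_minimum (vertex_in_K i) (F := fun x => (dotv (cost u) x)%:E)).
  congr ereal_inf; apply: eq_imagel => x _.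
  by rewrite mul0e sube0.
by move=> y Ky; rewrite lee_fin; exact: cell_min.
Qed.

(** Both v i and x are compared with f through [linearized_objective] at B v_i,
    where the square vanishes for v i but not for x. *)
Lemma optimal_vertex_slack i : (forall x, K x -> f (v i) <= f x) ->
  forall x, K x -> 2^-1 * l2norm (B *m v i - B *m x) ^+ 2 <=
    dotv (cost (B *m v i)) x - dotv (cost (B *m v i)) (v i).
Proof.
move=> fi x Kx; rewrite lerBrDr -(lerD2l (2^-1 * l2norm (B *m v i) ^+ 2)).
rewrite linearized_objective addrCA linearized_objective subrr.
by rewrite l2norm0 expr0n mulr0 add0r lerD2l fi.
Qed.

Lemma optimal_vertex_cell i : (forall x, K x -> f (v i) <= f x) ->
  cell c B v i (B *m v i).
Proof.
move=> fi j _; rewrite -subr_ge0.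
apply: le_trans (optimal_vertex_slack fi (vertex_in_K j)).
by rewrite mulr_ge0 ?invr_ge0 ?sqr_ge0.
Qed.

Section Optimum.
Variable i0 : 'I_V.
Hypothesis i0_opt : forall x, K x -> f (v i0) <= f x.

Lemma gfun0_ge u : ((f (v i0))%:E <= gfun K c B 0 u)%E.
Proof.
have K0 : K !=set0 by exists (v i0); exact: vertex_in_K.
have [i /gfun0_cell ->] := cell_cover u K0.
rewrite lee_fin; apply: le_trans (i0_opt (vertex_in_K i)) _.
by rewrite lerDr mulr_ge0 ?invr_ge0 ?sqr_ge0.
Qed.

Lemma gfun0_optimal_vertex : gfun K c B 0 (B *m v i0) = (f (v i0))%:E.
Proof.
rewrite (gfun0_cell (optimal_vertex_cell i0_opt)) subrr.
by rewrite l2norm0 expr0n mulr0 add0r.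
Qed.

Lemma gfun0_inf : ereal_inf [set gfun K c B 0 u | u in setT] = (f (v i0))%:E.
Proof.
rewrite (@ereal_inf_minimum _ _ _ _ (B *m v i0)) ?gfun0_optimal_vertex// => u _.
exact: gfun0_ge.
Qed.

(** At a minimizer of the dual function lying in the cell of a vertex, the square
    in [gfun0_cell] has to vanish. *)
Lemma IstarP i : Istar K c B v i <-> forall x, K x -> f (v i) <= f x.
Proof.
split=> [[u [iu [_ umin]]] x Kx|fi].
  have := umin (B *m v i0) I; rewrite gfun0_optimal_vertex (gfun0_cell iu).
  rewrite lee_fin => fi; apply: le_trans (i0_opt Kx); apply: le_trans fi.
  by rewrite lerDr mulr_ge0 ?invr_ge0 ?sqr_ge0.
exists (B *m v i); split; first exact: optimal_vertex_cell.
split=> // u _; apply: le_trans (gfun0_ge u).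
rewrite (gfun0_cell (optimal_vertex_cell fi)) subrr lee_fin.
by rewrite l2norm0 expr0n mulr0 add0r; exact: fi (vertex_in_K _).
Qed.

Lemma alphaE : alpha K c B v =
  (ereal_inf [set gfun K c B 0 u | u in \bigcup_(i in ~` Istar K c B v) cell c B v i]
   - (f (v i0))%:E)%E.
Proof. by rewrite /alpha gfun0_inf. Qed.

Lemma alpha_gt0 : (0 < alpha K c B v)%E.
Proof.
rewrite alphaE.
have : (0 < ereal_inf [set (f (v i) - f (v i0))%:E | i in ~` Istar K c B v])%E.
  apply: ereal_inf_gt0_finite => i ni; rewrite lte_fin subr_gt0 ltNge.
  apply/negP => fi; apply: ni; apply/IstarP => x Kx.
  exact: le_trans fi (i0_opt Kx).
move=> /lt_le_trans; apply; rewrite leeBrDr//.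
apply: le_ereal_inf_tmp => _ [u [i ni iu] <-]; rewrite (gfun0_cell iu).
rewrite -leeBrDr//; apply: le_trans (ereal_inf_lbound _) _; first by exists i.
by rewrite /= -EFinB lee_fin lerD2r lerDr mulr_ge0 ?invr_ge0 ?sqr_ge0.
Qed.

End Optimum.

Section CellAtOptimum.
Variable i : 'I_V.
Hypothesis i_opt : forall x, K x -> f (v i) <= f x.
Local Notation p := (B *m v i).
Local Notation normal := (fun k => B *m v k - p).
Local Notation slack k := (dotv (cost p) (v k) - dotv (cost p) (v i)).

Lemma cell_halfspaces : cell c B v i =
  [set u | forall k, dotv (B *m v k - p) (u - p) <= slack k].
Proof.
have E u k : (dotv (B *m v k - p) (u - p) <= slack k) =
    (dotv (cost u) (v i) <= dotv (cost u) (v k)).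
  rewrite !cost_dotv !dotvBr !dotvBl ![dotv (B *m _) u]dotvC.
  rewrite ![dotv p (B *m v k)]dotvC.
  by apply/idP/idP; lra.
apply/seteqP; split=> u /= iu k; last by rewrite -E.
by rewrite E; have [->//|ki] := eqVneq k i; exact: iu.
Qed.

Lemma slack_ge k : 2^-1 * l2norm (B *m v k - p) ^+ 2 <= slack k.
Proof. by rewrite l2normBC; exact: optimal_vertex_slack (vertex_in_K k). Qed.

Lemma slack_ge0 k : 0 <= slack k.
Proof. by apply: le_trans (slack_ge k); rewrite mulr_ge0 ?invr_ge0 ?sqr_ge0. Qed.

(** An optimal vertex is sent strictly inside its cell, because by concavity the
    slack of every constraint that depends on u is positive. *)
Lemma gamma_gt0 : (0 < gamma_ c B v i)%E.
Proof.
pose g k := l2norm (B *m v k - p).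
have [k0 gk0|g0] := pickP (fun k => g k != 0); last first.
  rewrite /gamma_ cell_halfspaces.
  apply: lt_le_trans (@dist_bd_ge _ _ _ normal _ p slack_ge0 1 _).
    by rewrite lte_fin.
  move=> k; apply: le_trans (slack_ge0 k).
  by have /negbFE/eqP := g0 k; rewrite /g => ->; rewrite mulr0.
have [j gj minj] := @arg_minP _ _ _ k0 (fun k => g k != 0) g gk0.
have gj0 : 0 < g j by rewrite lt_def gj l2norm_ge0.
rewrite /gamma_ cell_halfspaces.
apply: lt_le_trans (@dist_bd_ge _ _ _ normal _ p slack_ge0 (2^-1 * g j) _).
  by rewrite lte_fin mulr_gt0// invr_gt0.
move=> k; apply: le_trans (slack_ge k); rewrite -mulrA ler_pM2l ?invr_gt0//.
rewrite expr2 -/(g k); have [->|gk] := eqVneq (g k) 0; first by rewrite !mulr0.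
by rewrite ler_wpM2r ?l2norm_ge0// minj.
Qed.

Lemma gamma_le k : B *m v k <> p ->
  (gamma_ c B v i <= (slack k / l2norm (B *m v k - p))%:E)%E.
Proof.
move=> /eqP kp; rewrite /gamma_ cell_halfspaces.
by apply: (@dist_bd_le _ _ _ normal _ _ slack_ge0); rewrite subr_eq0.
Qed.

Lemma optimal_vertex_argmin : argmin K (dotv (cost p)) (v i).
Proof.
split; first exact: vertex_in_K.
by move=> x Kx; apply: cell_min => //; exact: optimal_vertex_cell.
Qed.

Lemma kappaE : kappa K (cost p) =
  (ereal_inf [set (dotv (cost p) x)%:E |
      x in vertices K `\` argmin K (dotv (cost p))]
   - (dotv (cost p) (v i))%:E)%E.
Proof.
rewrite /kappa (ereal_inf_minimum optimal_vertex_argmin)// => y [Ky ymin].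
by rewrite lee_fin; have [_] := optimal_vertex_argmin; exact.
Qed.

Lemma kappa_gt0 : (0 < kappa K (cost p))%E.
Proof.
rewrite kappaE.
have : (0 < ereal_inf [set (slack k)%:E |
    k in [set k | ~ argmin K (dotv (cost p)) (v k)]])%E.
  apply: ereal_inf_gt0_finite => k nk; rewrite lte_fin subr_gt0 ltNge.
  apply/negP => ki; apply: nk; split; first exact: vertex_in_K.
  by move=> x Kx; apply: le_trans ki _; have [_] := optimal_vertex_argmin; exact.
move=> /lt_le_trans; apply; rewrite leeBrDr//.
apply: le_ereal_inf_tmp => _ [x [xV nx] <-].
move: xV nx; rewrite -v_vertices => -[k _ <-] nk.
by rewrite -leeBrDr//; apply: ereal_inf_lbound; exists k.
Qed.

Lemma kappa_le k : dotv (cost p) (v k) <> dotv (cost p) (v i) ->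
  (kappa K (cost p) <= (slack k)%:E)%E.
Proof.
move=> ki; rewrite kappaE EFinB; apply: leeD2r.
apply: ereal_inf_lbound; exists (v k) => //.
split; first by rewrite -v_vertices; exists k.
move=> [_ kmin]; apply: ki; apply/eqP; rewrite eq_le (kmin _ (vertex_in_K i))/=.
by have [_] := optimal_vertex_argmin; apply; exact: vertex_in_K.
Qed.

Lemma Delta_gt0 : (0 < Delta_ K c B v i)%E.
Proof.
rewrite /Delta_ lt_min kappa_gt0/=; apply: mule_gt0; last first.
  apply: ereal_inf_gt0_finite => k /eqP kp.
  by rewrite lte_fin lt_def l2norm_ge0 l2norm_eq0 subr_eq0 kp.
by rewrite mule_gt0 ?gamma_gt0// inver pnatr_eq0 lte_fin invr_gt0.
Qed.

(** Moving u by at most gamma_i / 2 from B v_i uses up at most half of the slack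
    of a constraint that depends on u; the other slacks do not move. *)
Lemma Delta_le u k : ((l2norm (u - p))%:E <= gamma_ c B v i / 2%:E)%E ->
  ~~ ((B *m v k == p) && (dotv c (v k) == dotv c (v i))) ->
  (Delta_ K c B v i <= (dotv (cost u) (v k) - dotv (cost u) (v i))%:E)%E.
Proof.
move=> up; rewrite /Delta_ ge_min; have [kp|kp] /= := eqVneq (B *m v k) p.
  move=> /eqP cki; apply/orP; left.
  have E w : dotv (cost w) (v k) - dotv (cost w) (v i) = dotv c (v k) - dotv c (v i).
    by rewrite !cost_dotv kp; ring.
  rewrite E -(E p); apply: kappa_le => /eqP; rewrite -subr_eq0 E subr_eq0.
  by move=> /eqP.
move=> _; apply/orP; right; move/eqP: kp => kp.
have gk0 : 0 < l2norm (B *m v k - p).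
  by rewrite lt_def l2norm_ge0 l2norm_eq0 subr_eq0 andbT; exact/eqP.
have := gamma_le kp; move: up gamma_gt0.
rewrite inver pnatr_eq0/=; case: (gamma_ c B v i) => [g| |] //.
rewrite -EFinM !lee_fin lte_fin => up g0.
rewrite ler_pdivlMr// => gk.
apply: (@le_trans _ _ ((g / 2)%:E * (l2norm (B *m v k - p))%:E)%E).
  rewrite lee_wpmul2l ?lee_fin ?divr_ge0 ?(ltW g0)//.
  by apply: ereal_inf_lbound; exists k.
rewrite -EFinM lee_fin.
have -> : dotv (cost u) (v k) - dotv (cost u) (v i) =
    slack k - dotv (B *m v k - p) (u - p).
  rewrite !cost_dotv !dotvBr !dotvBl ![dotv (B *m _) u]dotvC.
  by rewrite ![dotv p (B *m v k)]dotvC; ring.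
have := cauchy_schwarz (B *m v k - p) (u - p).
have : l2norm (B *m v k - p) * l2norm (u - p) <= l2norm (B *m v k - p) * (g / 2).
  by rewrite ler_pM2l.
by lra.
Qed.

End CellAtOptimum.

End Dual.

(** * Solutions of the regularized problem *)

Section PolytopeSize.
Context {R : realType} {m n : nat} (A : 'M[R]_(m, n)) (b : 'cV[R]_m).
Local Notation K := (polyhedron A b).
Hypotheses (K_nonempty : K !=set0) (K_bounded : bounded_set K).

Lemma polytope_l1norm_le : exists a : R, forall x, K x -> l1norm x <= a.
Proof.
have [a Ka] := bounded_polyhedron_coord K_bounded.
exists (\sum_(i < n) a) => x Kx; rewrite (l1norm_nonneg Kx.2).
by apply: ler_sum => i _; exact: Ka.
Qed.

Lemma R1_fin : exists a : R, R1 K = a%:E /\ forall x, K x -> l1norm x <= a.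
Proof.
have [a Ka] := polytope_l1norm_le; have [x0 Kx0] := K_nonempty.
have [||s [sE Ks]] := @ereal_sup_fin R [set (l1norm x)%:E | x in K] a.
- by exists (l1norm x0)%:E, x0.
- by move=> _ [x Kx <-]; exists (l1norm x) => //; exact: Ka.
by exists s; split => // x Kx; apply: Ks; exists x.
Qed.

Lemma RH_fin : exists h : R, RH K = h%:E /\
  forall x y, K x -> K y -> rentropy x - rentropy y <= h.
Proof.
have [a Ka] := polytope_l1norm_le; have [x0 Kx0] := K_nonempty.
have E x y : K x -> K y ->
    (entropy x - entropy y)%E = (rentropy x - rentropy y)%:E.
  by move=> Kx Ky; rewrite !entropyE ?EFinB//; [exact: Ky.2|exact: Kx.2].
have [||s [sE Ks]] := @ereal_sup_fin R
  [set (entropy x - entropy x')%E | x in K & x' in K] (n%:R + a ^+ 2).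
- by exists (entropy x0 - entropy x0)%E, x0 => //; exists x0.
- move=> _ [x Kx [y Ky <-]]; exists (rentropy x - rentropy y); first exact: E.
  have := rentropy_le Kx.2; have := rentropy_ge Ky.2.
  have : l1norm y ^+ 2 <= a ^+ 2.
    have y0 : 0 <= l1norm y by rewrite sumr_ge0.
    by rewrite ler_sqr ?nnegrE ?Ka//; apply: le_trans y0 (Ka _ Ky).
  by lra.
exists s; split => // x y Kx Ky; apply: Ks.
by exists x => //; exists y => //; exact: E.
Qed.

End PolytopeSize.

Section EntropicSolution.
Context {R : realType} {m n r V : nat}.
Variables (A : 'M[R]_(m, n)) (b : 'cV[R]_m) (c : 'cV[R]_n) (B : 'M[R]_(r, n)).
Variable v : 'I_V -> 'cV[R]_n.
Local Notation K := (polyhedron A b).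
Local Notation cost u := (c - B^T *m u).
Local Notation f := (objective (B^T *m B) c).
Hypothesis K_bounded : bounded_set K.
Hypothesis v_vertices : range v = vertices K.
Variables (eps h : R) (x : 'cV[R]_n).
Hypothesis eps_gt0 : 0 < eps.
Hypothesis K_h : forall y z, K y -> K z -> rentropy y - rentropy z <= h.
Hypothesis Kx : K x.
Hypothesis x_opt : forall y, K y ->
  f x - eps * rentropy x <= f y - eps * rentropy y.

(** Concavity: f lies below its linearization at x, which touches it at x. *)
Lemma entropic_solution_linearized y : K y ->
  dotv (cost (B *m x)) x - eps * rentropy x <=
  dotv (cost (B *m x)) y - eps * rentropy y.
Proof.
move=> Ky; have := x_opt Ky.
have := linearized_objective c B (B *m x) y.
have := linearized_objective c B (B *m x) x.
rewrite subrr l2norm0 expr0n/=.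
have : 0 <= 2^-1 * l2norm (B *m x - B *m y) ^+ 2.
  by rewrite mulr_ge0 ?invr_ge0 ?sqr_ge0.
by lra.
Qed.

(** The dual point B x is nearly optimal for the unregularized dual, so that it
    lies in the cell of an optimal vertex, close to the image of that vertex. *)
Lemma entropic_solution_cell : ((eps * h)%:E < alpha K c B v)%E ->
  exists i, [/\ forall y, K y -> f (v i) <= f y, cell c B v i (B *m x) &
    2^-1 * l2norm (B *m x - B *m v i) ^+ 2 <= eps * h].
Proof.
move=> small; have K0 : K !=set0 by exists x.
have [i0 i0_opt] := best_vertex c B K_bounded v_vertices K0.
have [i ix] := cell_cover c B K_bounded v_vertices (B *m x) K0.
have gx : 2^-1 * l2norm (B *m x - B *m v i) ^+ 2 + f (v i) <= f (v i0) + eps * h.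
  rewrite -linearized_objective.
  have := cell_min K_bounded v_vertices ix Kx.
  have := linearized_objective c B (B *m x) x.
  rewrite subrr l2norm0 expr0n/=.
  have := x_opt (vertex_in_K v_vertices i0).
  have : eps * (rentropy x - rentropy (v i0)) <= eps * h.
    by rewrite ler_pM2l// K_h//; exact: vertex_in_K.
  by lra.
have fi : forall y, K y -> f (v i) <= f y.
  apply/(IstarP K_bounded v_vertices i0_opt); apply: contrapT => ni.
  move: small; rewrite (alphaE K_bounded v_vertices i0_opt) lteBrDr// => small.
  have : ((eps * h)%:E + (f (v i0))%:E < gfun K c B 0 (B *m x))%E.
    apply: lt_le_trans small _; apply: ereal_inf_lbound.
    by exists (B *m x) => //; exists i.
  by rewrite (gfun0_cell K_bounded v_vertices ix) -EFinD lte_fin; lra.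
exists i; split => //.
have := i0_opt _ (vertex_in_K v_vertices i).
by have := fi _ (vertex_in_K v_vertices i0); lra.
Qed.

(** If B x is close to the image of an optimal vertex v i, then every vertex is
    either equivalent to v i, hence optimal, or costs at least Delta_i more under
    the linearization at x. The weight that x puts on vertices of the second kind
    is controlled by [entropic_weight_le]. If there is such weight, some vertex
    has a finite excess cost, here D, so that Delta_i is finite. *)
Lemma entropic_solution_dist i (a : R) : 0 < a ->
  (forall y, K y -> l1norm y <= a) ->
  (forall y, K y -> f (v i) <= f y) ->
  ((l2norm (B *m x - B *m v i))%:E <= gamma_ c B v i / 2%:E)%E ->
  argmin K f x \/ exists2 y, argmin K f y & exists2 D : R,
    (Delta_ K c B v i <= D%:E)%E & forall D' : R, (D'%:E <= Delta_ K c B v i)%E ->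
    l2norm (x - y) <= 2 * a * expR (- D' / (eps * a) + (a + h) / a).
Proof.
move=> a0 Ka fi near_i; pose u := B *m x.
pose P k := (B *m v k == B *m v i) && (dotv c (v k) == dotv c (v i)).
have gap k : ~~ P k ->
    (Delta_ K c B v i <= (dotv (cost u) (v k) - dotv (cost u) (v i))%:E)%E.
  exact: Delta_le.
have argminP y : hull v P y -> argmin K f y.
  move=> Py; have Ky : K y by apply: hull_sub_polyhedron Py; exact: vertex_in_K.
  split => // z Kz; apply: le_trans (fi _ Kz); rewrite le_eqVlt; apply/orP; left.
  have By : B *m y = B *m v i by apply: hull_mulmx Py => k /andP[/eqP].
  have cy : dotv c y = dotv c (v i) by apply: hull_dotv_eq Py => k /andP[_ /eqP].
  by rewrite /objective cy -!mulmxA By -!(dotvC (B^T *m _)) !dotv_trmx By.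
have Pi : P i by rewrite /P !eqxx.
have [Px|[t [y [z [t01 Py Pz xE]]]]] :=
  hull_split Pi (K_hull K_bounded v_vertices Kx); first by left; exact: argminP.
right; exists y; first exact: argminP.
have [Ky _] := argminP _ Py.
have Kz : K z by apply: hull_sub_polyhedron Pz; exact: vertex_in_K.
have uy : dotv (cost u) y = dotv (cost u) (v i).
  apply: hull_dotv_eq Py => k /andP[/eqP Bk /eqP ck].
  by rewrite !cost_dotv Bk ck.
have [k Pk] : exists k, ~~ P k.
  apply: contrapT => nP; have [l [_ lP l1 _]] := Pz; move: l1.
  rewrite big1 => [/eqP|k _]; first by rewrite eq_sym oner_eq0.
  by apply: lP; rewrite /= negbK; apply: contrapT => /negP Pk; apply: nP; exists k.
exists (dotv (cost u) (v k) - dotv (cost u) (v i)); first exact: gap.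
move=> D DD; have t_le : t <= expR (- D / (eps * a) + (a + h) / a).
  apply: (@entropic_weight_le _ _ (cost u) x y z t a h D eps) => //.
  - exact: Ky.2.
  - exact: Kz.2.
  - exact: Ka.
  - exact: Ka.
  - exact: K_h.
  - rewrite lerBrDr; apply: hull_dotv_ge Pz => j /= Pj.
    by rewrite uy -lerBrDr -lee_fin; apply: le_trans DD (gap _ Pj).
  - exact: entropic_solution_linearized.
have /andP[/ltW t0 t1] := t01.
have -> : x - y = t *: (z - y).
  by rewrite xE; apply/matrixP => j l; rewrite !mxE; ring.
rewrite l2normZ// mulrC; apply: ler_pM => //; first exact: l2norm_ge0.
apply: le_trans (l2norm_le_l1norm _) _; apply: le_trans (l1normB _ _) _.
by rewrite mulr_natl mulr2n lerD ?Ka.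
Qed.

End EntropicSolution.

Theorem theorem3 (R : realType) (m n r V : nat)
  (A : 'M[R]_(m, n)) (b : 'cV[R]_m) (c : 'cV[R]_n)
  (M : 'M[R]_n) (B : 'M[R]_(r, n)) (v : 'I_V -> 'cV[R]_n)
  (K := polyhedron A b)
  (M_sym : M^T = M)
  (M_psd : forall x : 'cV[R]_n, 0 <= dotv x (M *m x))
  (M_fact : M = B^T *m B)
  (r_le_n : (r <= n)%N)
  (K_nonempty : K !=set0)
  (K_bounded : bounded_set K)
  (obj_nonconstant :
     exists x y, [/\ K x, K y & objective M c x <> objective M c y])
  (v_inj : injective v)
  (v_vertices : range v = vertices K) :
  (0 < alpha K c B v)%E /\
  (forall i, Istar K c B v i ->
     (0 < gamma_ c B v i)%E /\ (0 < Delta_ K c B v i)%E) /\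
  (forall eps : R, 0 < eps ->
     (eps%:E < mine (alpha K c B v / RH K)
                 (mine (gamma_min K c B v ^+ 2 / (8%:E * RH K))
                       (Delta_min K c B v / (R1 K + RH K))))%E ->
     forall x : 'cV[R]_n,
       argmin K (fun x => ((objective M c x)%:E - eps%:E * entropy x)%E) x ->
       (dist x (argmin K (objective M c)) <=
        2%:E * R1 K *
        expeR (- Delta_min K c B v / (2%:E * eps%:E * R1 K)
               + (R1 K + RH K) / R1 K))%E).
Proof.
have [i0 i0_opt] := best_vertex c B K_bounded v_vertices K_nonempty.
have opt i : Istar K c B v i ->
    forall x, K x -> objective (B^T *m B) c (v i) <= objective (B^T *m B) c x.
  by move/(IstarP K_bounded v_vertices i0_opt).
have alpha0 := alpha_gt0 K_bounded v_vertices i0_opt.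
have gamma0 i : Istar K c B v i -> (0 < gamma_ c B v i)%E.
  by move=> /opt; exact: (gamma_gt0 v_vertices).
have Delta0 i : Istar K c B v i -> (0 < Delta_ K c B v i)%E.
  by move=> /opt; exact: (Delta_gt0 K_bounded v_vertices).
split => //; split => [i Ii|eps eps0]; first by split; [exact: gamma0|exact: Delta0].
have [a [R1E Ka]] := R1_fin K_nonempty K_bounded.
have [h [RHE Kh]] := RH_fin K_nonempty K_bounded.
have h0 : 0 <= h by have [x Kx] := K_nonempty; rewrite -(subrr (rentropy x)) Kh.
have a0 : 0 < a.
  (* If R_1 = 0 then K = {0} and the objective is constant. *)
  rewrite ltNge; apply/negP => a_le0; have [x [y [Kx Ky]]] := obj_nonconstant.
  have K0 z : K z -> z = 0.
    move=> Kz; apply/eqP; rewrite -l2norm_eq0 eq_le l2norm_ge0 andbT.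
    by apply: le_trans (l2norm_le_l1norm z) (le_trans (Ka _ Kz) a_le0).
  by rewrite (K0 _ Kx) (K0 _ Ky).
rewrite R1E RHE !lt_min => /and3P[eps_alpha eps_gamma _] x [Kx xmin].
rewrite M_fact in xmin *.
have x_opt y : K y -> objective (B^T *m B) c x - eps * rentropy x
    <= objective (B^T *m B) c y - eps * rentropy y.
  move=> Ky; have := xmin _ Ky; rewrite !entropyE ?lee_fin//; last exact: Kx.2.
  exact: Ky.2.
have [i [fi _ near_i]] := entropic_solution_cell K_bounded v_vertices eps0 Kh Kx
  x_opt (lt_div_nneg_ereal h0 alpha0 eps_alpha).
have Ii : Istar K c B v i by apply/(IstarP K_bounded v_vertices i0_opt).
have gm0 : (0 < gamma_min K c B v)%E by apply: ereal_inf_gt0_finite.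
have gmi : (gamma_min K c B v <= gamma_ c B v i)%E.
  by apply: ereal_inf_lbound; exists i.
have Dm0 : (0 < Delta_min K c B v)%E by apply: ereal_inf_gt0_finite.
have Dmi : (Delta_min K c B v <= Delta_ K c B v i)%E.
  by apply: ereal_inf_lbound; exists i.
have half : ((2%:E)^-1 = (2^-1)%:E :> \bar R)%E by rewrite inver pnatr_eq0.
have {}near_i : ((l2norm (B *m x - B *m v i))%:E <= gamma_ c B v i / 2%:E)%E.
  apply: (@le_trans _ _ (gamma_min K c B v / 2%:E)%E); last first.
    by apply: lee_wpmul2r gmi; rewrite half lee_fin invr_ge0.
  (* From |B x - B v_i|^2 <= 2 eps R_H and 8 eps R_H < gamma^2. *)
  move: eps_gamma gm0; rewrite half -EFinM.
  case: (gamma_min K c B v) => [g|_ _|]//; last first.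
    by rewrite gt0_mulye ?leey// lte_fin invr_gt0.
  rewrite -EFin_expe lte_fin => eps_g g0.
  have : ((eps * (8 * h))%:E < (g ^+ 2)%:E)%E.
    by apply: lt_div_nneg_ereal eps_g; rewrite ?mulr_ge0// lte_fin exprn_gt0.
  rewrite lte_fin -EFinM lee_fin => eg.
  rewrite -ler_sqr ?nnegrE ?l2norm_ge0 ?mulr_ge0 ?invr_ge0 ?(ltW g0)//.
  by rewrite exprMn; nra.
have dist_le y : argmin K (objective (B^T *m B) c) y ->
    (dist x (argmin K (objective (B^T *m B) c)) <= (l2norm (x - y))%:E)%E.
  by move=> y_opt; apply: ereal_inf_lbound; exists y.
have [xx|[y yy [D DiD bound]]] := entropic_solution_dist K_bounded v_vertices eps0 Kh
  Kx x_opt a0 Ka fi near_i.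
  apply: le_trans (dist_le _ xx) _; rewrite subrr l2norm0.
  by rewrite mule_ge0 ?expeR_ge0// -EFinM lee_fin mulr_ge0// ltW.
apply: le_trans (dist_le _ yy) _.
have := le_trans Dmi DiD; move: Dm0 Dmi.
case: (Delta_min K c B v) => [D'| |]//; rewrite lte_fin => D'0 /bound {}bound _.
rewrite -!EFinM !inver !gt_eqF ?mulr_gt0//= lee_fin.
apply: le_trans bound _; rewrite ler_wpM2l ?mulr_ge0 ?(ltW a0)// ler_expR lerD2r.
rewrite !mulNr lerN2 ler_wpM2l ?(ltW D'0)//.
by rewrite lef_pV2 ?posrE ?mulr_gt0// -mulrA ler_peMl ?mulr_ge0 ?ltW// ltr1n.
Qed.
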